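(* Let $\Pi$ be a translation-invariant point process on $\mathbb{R}^d$. Then $\Pi$ is insertion-tolerant if and only if there exists a Borel set $S\subseteq\mathbb{R}^d$ with Lebesgue measure in $(0,\infty)$ such that, if $U$ is uniformly distributed in $S$ and independent of $\Pi$, then $\Pi+\delta_U\prec\Pi$.
   Context: Point processes are always simple and locally finite, i.e. random elements of the space $\mathbb{M}$ of simple locally finite point measures on $\mathbb{R}^d$, equipped with the $\sigma$-field generated by the evaluations $\mu\mapsto\mu(A)$, $A$ Borel. A point process is translation-invariant if its law is invariant under all translations of $\mathbb{R}^d$. For random variables $X,Y$ with values in the same measurable space, $X\prec Y$ means that $\mathbb{P}(Y\in\mathcal{A})=0$ implies $\mathbb{P}(X\in\mathcal{A})=0$ for all measurable $\mathcal{A}$. For $x\in\mathbb{R}^d$, $\delta_x$ is the point measure at $x$. $\Pi$ is insertion-tolerant if for every Borel set $S\subseteq\mathbb{R}^d$ with Lebesgue measure in $(0,\infty)$, if $U$ is uniformly distributed on $S$ and independent of $\Pi$, then $\Pi+\delta_U\prec\Pi$. *)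

(* Defs.v *)
From HB Require Import structures.
From mathcomp Require Import all_boot all_order all_algebra.
From mathcomp Require Import all_classical all_reals all_analysis.
From mathcomp Require Import measurable_realfun.

Set Implicit Arguments.
Unset Strict Implicit.
Unset Printing Implicit Defensive.

Import Order.TTheory GRing.Theory Num.Theory.
Import numFieldNormedType.Exports.

Local Open Scope classical_set_scope.
Local Open Scope ring_scope.

Section borel_matrix.
Context (R : realType) (m n : nat).

Definition mx_borel : set (set 'M[R]_(m, n)) := <<s @open 'M[R]_(m, n) >>.

Let mx_borel0 : mx_borel set0.
Proof. exact: sigma_algebra0. Qed.

Let mx_borelC (A : set 'M[R]_(m, n)) : mx_borel A -> mx_borel (~` A).
Proof. exact: sigma_algebraC. Qed.

Let mx_borelU (F : (set 'M[R]_(m, n))^nat) :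
  (forall i, mx_borel (F i)) -> mx_borel (\bigcup_i F i).
Proof. exact: sigma_algebra_bigcup. Qed.

Definition mx_borel_display : measure_display.
Proof. by constructor. Qed.

HB.instance Definition _ := @isMeasurable.Build mx_borel_display
  'M[R]_(m, n) mx_borel mx_borel0 mx_borelC mx_borelU.

Lemma open_measurable_mx (A : set 'M[R]_(m, n)) : open A -> measurable A.
Proof. by move=> oA; exact: sub_sigma_algebra. Qed.

Lemma measurable_mx_coord (i : 'I_m) (j : 'I_n) :
  measurable_fun [set: 'M[R]_(m, n)] (fun M => M i j).
Proof.
apply: (measurability _ (RGenOpens.measurableE R)) => _ [_ [x [y ->]] <-].
rewrite setTI; apply: open_measurable_mx.
by apply: open_comp => [M _|]; [exact: coord_continuous|exact: itv_open].
Qed.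

Lemma measurable_fun_mxP d (T : measurableType d) (f : T -> 'M[R]_(m, n)) :
  measurable_fun [set: T] f <->
  forall i j, measurable_fun [set: T] (fun t => f t i j).
Proof.
split=> [mf i j|mf].
  exact: (measurableT_comp (measurable_mx_coord i j) mf).
pose box (q : {ffun 'I_m * 'I_n -> rat * rat}) : set 'M[R]_(m, n) :=
  [set M | forall ij, ratr (q ij).1 < M ij.1 ij.2 < ratr (q ij).2].
apply: (measurability (@open 'M[R]_(m, n))) => // _ [A oA <-].
have -> : A = \bigcup_q (if `[< box q `<=` A >] then box q else set0).
  apply/seteqP; split=> [M AM|M [q _]]; last by case: asboolP => // qA /qA.
  have /nbhs_ballP[e /= e0 eA] : nbhs M A by exact: open_nbhs_nbhs.
  have lo ij : {q : rat | M ij.1 ij.2 - e < ratr q < M ij.1 ij.2}.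
    apply/cid; have : M ij.1 ij.2 - e < M ij.1 ij.2 by rewrite ltrBlDr ltrDl.
    by move=> /rat_in_itvoo[q]; rewrite in_itv /=; exists q.
  have hi ij : {q : rat | M ij.1 ij.2 < ratr q < M ij.1 ij.2 + e}.
    apply/cid; have : M ij.1 ij.2 < M ij.1 ij.2 + e by rewrite ltrDl.
    by move=> /rat_in_itvoo[q]; rewrite in_itv /=; exists q.
  exists [ffun ij => (sval (lo ij), sval (hi ij))] => //.
  rewrite asboolT /box /=.
    move=> ij; rewrite ffunE /=.
    by case: (lo ij) => /= ? /andP[_ ->]; case: (hi ij) => /= ? /andP[-> _].
  move=> N /= boxN; apply: eA; split => // i j.
  have := boxN (i, j); rewrite ffunE /=.
  case: (lo (i, j)) => /= p /andP[p1 _]; case: (hi (i, j)) => /= q /andP[_ q2].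
  move=> /andP[pN Nq]; rewrite /ball /= distrC ltr_distl.
  by rewrite (lt_trans p1 pN) (lt_trans Nq q2).
rewrite setTI preimage_bigcup.
apply: countable_bigcupT_measurable => [|q]; first exact: countableP.
case: asboolP => _; last by rewrite preimage_set0.
rewrite (_ : _ @^-1` _ = \bigcap_ij
    ((fun t => f t ij.1 ij.2) @^-1` `](ratr (q ij).1), (ratr (q ij).2)[)).
  apply: fin_bigcap_measurable => [|ij _]; first exact: finite_finset.
  by rewrite -[X in measurable X]setTI; exact: mf.
apply/seteqP; split=> t /= qt; first by move=> ij _ /=; rewrite in_itv /= qt.
by move=> ij; have := qt ij I; rewrite /= in_itv.
Qed.

End borel_matrix.

Section lebesgue_rV.
Context (R : realType).
Local Open Scope ereal_scope.

Definition consrV n (xy : R * 'rV[R]_n) : 'rV[R]_n.+1 :=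
  row_mx (xy.1%:M : 'M[R]_1) xy.2.

Lemma consrV0 n (xy : R * 'rV[R]_n) : consrV xy ord0 ord0 = xy.1.
Proof.
rewrite (_ : (ord0 : 'I_n.+1) = lshift n (ord0 : 'I_1)); last exact: val_inj.
by transitivity ((xy.1%:M : 'M[R]_1) ord0 ord0); [exact: row_mxEl|rewrite mxE].
Qed.

Lemma consrVS n (xy : R * 'rV[R]_n) (i : 'I_n) :
  consrV xy ord0 (lift ord0 i) = xy.2 ord0 i.
Proof.
rewrite (_ : lift ord0 i = rshift 1 i); last exact: val_inj.
exact: row_mxEr.
Qed.

Lemma measurable_consrV n : measurable_fun [set: R * 'rV[R]_n] (@consrV n).
Proof.
apply/measurable_fun_mxP => i j; rewrite (ord1 i).
have [k ->|->] := unliftP ord0 j.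
  rewrite (_ : (fun _ => _) = (fun M : 'rV_n => M ord0 k) \o snd).
    exact: (measurableT_comp (measurable_mx_coord _ _)).
  by apply/funext => xy; rewrite consrVS.
rewrite (_ : (fun _ => _) = fst); first exact: measurable_fst.
by apply/funext => xy; rewrite consrV0.
Qed.

Lemma measurable_box n (A : 'I_n -> set R) : (forall i, measurable (A i)) ->
  measurable [set v : 'rV[R]_n | forall i, A i (v ord0 i)].
Proof.
move=> mA; rewrite (_ : [set v | _] = \bigcap_i
    ((fun v : 'rV[R]_n => v ord0 i) @^-1` A i)).
  apply: fin_bigcap_measurable => [|i _]; first exact: finite_finset.
  by rewrite -[X in measurable X]setTI; exact: measurable_mx_coord.
by apply/seteqP; split => v /= h i; [move=> _; exact: h|exact: h].
Qed.

(* Lebesgue measure on R^n, as the iterated integral of the slices. *)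
Fixpoint lebesgue_rV n : set 'rV[R]_n -> \bar R :=
  match n with
  | 0%N => \d_(0%R : 'rV[R]_0)
  | n'.+1 => fun A => \int[@lebesgue_measure R]_x
                        lebesgue_rV [set y : 'rV[R]_n' | A (consrV (x, y))]
  end.

Lemma lebesgue_rVS n : @lebesgue_rV n.+1 =
  pushforward (@lebesgue_measure R \x @lebesgue_rV n) (@consrV n).
Proof.
apply/funext => A /=; apply: eq_integral => x _ /=; congr lebesgue_rV.
by apply/seteqP; split => y; rewrite /xsection /= in_setE.
Qed.

Let rV_struct n : [/\ @lebesgue_rV n set0 = 0,
  forall A, 0 <= @lebesgue_rV n A,
  semi_sigma_additive (@lebesgue_rV n),
  sigma_finite setT (@lebesgue_rV n) &
  forall A : 'I_n -> set R, (forall i, measurable (A i)) ->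
    @lebesgue_rV n [set v | forall i, A i (v ord0 i)] =
    \prod_(i < n) lebesgue_measure (A i)].
Proof.
elim: n => [|n [m0 mge0 madd msf mbox]].
  split; [exact: measure0|exact: measure_ge0|exact: measure_semi_sigma_additive
    |exact: (sigma_finiteT (\d_(0%R : 'rV[R]_0)))|].
  by move=> A mA; rewrite big_ord0 /= diracE mem_set //= => -[].
pose mm := isMeasure.Build _ _ _ (@lebesgue_rV n) m0 mge0 madd.
pose m1 : {measure set 'rV[R]_n -> \bar R} := HB.pack (@lebesgue_rV n) mm.
pose ms := Measure_isSigmaFinite.Build _ _ _ m1 msf.
pose m : {sigma_finite_measure set 'rV[R]_n -> \bar R} :=
  HB.pack (@lebesgue_rV n) mm ms.
rewrite lebesgue_rVS.
pose M := pushforward (@lebesgue_measure R \x m) (@consrV n).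
rewrite -[pushforward _ _]/M.
have Mbox (A : 'I_n.+1 -> set R) : (forall i, measurable (A i)) ->
    M [set v : 'rV[R]_n.+1 | forall i, A i (v ord0 i)] =
    \prod_(i < n.+1) lebesgue_measure (A i).
  move=> mA; rewrite big_ord_recl -mbox//.
  have -> : M [set v : 'rV[R]_n.+1 | forall i, A i (v ord0 i)] =
      (@lebesgue_measure R \x m)
      (A ord0 `*` [set v : 'rV[R]_n | forall i, A (lift ord0 i) (v ord0 i)]).
    rewrite /M /pushforward; congr (_ _); apply/seteqP; split => -[x y] /=.
      move=> h; split => [|i]; first by have := h ord0; rewrite consrV0.
      by have := h (lift ord0 i); rewrite consrVS.
    by move=> [h0 h] i; have [k ->|->] := unliftP ord0 i;
      rewrite ?consrVS ?consrV0.
  by rewrite product_measure1E; [ |exact: mA|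
    apply: (measurable_box (A := fun i => A (lift ord0 i)))].
have M0 : M set0 = 0 by rewrite /M /pushforward preimage_set0 measure0.
split => //.
- by move=> A; rewrite /M /pushforward measure_ge0.
- by have mc := @measurable_consrV n; exact: measure_semi_sigma_additive.
- exists (fun k : nat => [set v : 'rV[R]_n.+1 |
      forall i, `[(- k%:R)%R, k%:R%R]%classic (v ord0 i)]).
    apply/esym/seteqP; split => // v _.
    exists (Num.truncn `|v|).+1 => // i /=; rewrite in_itv /= -ler_norml.
    apply: le_trans (ltW (truncnS_gt _)).
    rewrite [leRHS]/Num.norm /= mx_normrE.
    exact: (le_bigmax _ (fun ij => `|v ij.1 ij.2|%R) (ord0, i)).
  move=> k; split.
    apply: (measurable_box (A := fun=> `[(- k%:R)%R, k%:R%R]%classic)) => i.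
    exact: measurable_itv.
  rewrite [ltLHS](Mbox (fun=> `[(- k%:R)%R, k%:R%R]%classic)) => [|i];
    last exact: measurable_itv.
  under eq_bigr do rewrite lebesgue_measure_itv /=.
  case: ifPn => _; last by rewrite big_ord_recl mul0e.
  by under eq_bigr do rewrite -EFinB; rewrite prodEFin ltry.
Qed.

HB.instance Definition _ n := isMeasure.Build _ _ _ (@lebesgue_rV n)
  (let: And5 h _ _ _ _ := rV_struct n in h)
  (let: And5 _ h _ _ _ := rV_struct n in h)
  (let: And5 _ _ h _ _ := rV_struct n in h).

HB.instance Definition _ n := Measure_isSigmaFinite.Build _ _ _ (@lebesgue_rV n)
  (let: And5 _ _ _ h _ := rV_struct n in h).

Lemma lebesgue_rV_box n (A : 'I_n -> set R) : (forall i, measurable (A i)) ->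
  lebesgue_rV [set v | forall i, A i (v ord0 i)] =
  \prod_(i < n) lebesgue_measure (A i).
Proof. by have [_ _ _ _] := rV_struct n; exact. Qed.

End lebesgue_rV.

Section measure_space.
Context d (T : measurableType d) (R : realType).

Definition measures : Type := {measure set T -> \bar R}.

HB.instance Definition _ := gen_eqMixin measures.
HB.instance Definition _ := gen_choiceMixin measures.
HB.instance Definition _ := isPointed.Build measures (@mzero d T R).

Definition evaluation_sets : set (set measures) :=
  \bigcup_(A in @measurable d T)
    preimage_set_system [set: measures] (fun mu => mu A) measurable.

Definition measures_measurable : set (set measures) := <<s evaluation_sets >>.

Let measures_measurable0 : measures_measurable set0.
Proof. exact: sigma_algebra0. Qed.

Let measures_measurableC (F : set measures) :
  measures_measurable F -> measures_measurable (~` F).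
Proof. exact: sigma_algebraC. Qed.

Let measures_measurableU (F : (set measures)^nat) :
  (forall i, measures_measurable (F i)) -> measures_measurable (\bigcup_i F i).
Proof. exact: sigma_algebra_bigcup. Qed.

Definition measures_display : measure_display.
Proof. by constructor. Qed.

HB.instance Definition _ := @isMeasurable.Build measures_display measures
  measures_measurable measures_measurable0 measures_measurableC
  measures_measurableU.

Lemma measurable_evaluation (A : set T) : measurable A ->
  measurable_fun [set: measures] (fun mu => mu A).
Proof.
move=> mA _ B mB; apply: sub_sigma_algebra.
by exists A => //; exists B.
Qed.

Lemma measurable_fun_measuresP d' (X : measurableType d') (f : X -> measures) :
  measurable_fun [set: X] f <->
  forall A, measurable A -> measurable_fun [set: X] (fun x => f x A).
Proof.
split=> [mf A mA|mf].
  exact: (measurableT_comp (measurable_evaluation mA) mf).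
apply: (measurability evaluation_sets) => // _ [_ [A mA [B mB <-]] <-].
by rewrite !setTI -[X in measurable X]setTI; exact: mf.
Qed.

Definition add_point (mu : measures) (x : T) : measures :=
  msum (fun k => if k is 0%N then mu else \d_x) 2.

Lemma add_pointE (mu : measures) (x : T) (A : set T) :
  add_point mu x A = (mu A + \d_x A)%E.
Proof. by rewrite /add_point /= /msum 2!big_ord_recl /= big_ord0 adde0. Qed.

Lemma measurable_add_point d' (X : measurableType d') (f : X -> measures)
    (g : X -> T) : measurable_fun [set: X] f -> measurable_fun [set: X] g ->
  measurable_fun [set: X] (fun x => add_point (f x) (g x)).
Proof.
move=> /measurable_fun_measuresP mf mg; apply/measurable_fun_measuresP => A mA.
under eq_fun do rewrite add_pointE.
apply: emeasurable_funD; first exact: mf.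
rewrite (_ : (fun _ => _) = fun x => (\1_A (g x) : R)%:E).
  apply/measurable_EFinP.
  have m1 : measurable_fun [set: T] (\1_A : T -> R) by exact: measurable_indic.
  exact: (measurableT_comp m1 mg).
by apply/funext => x; rewrite diracE indicE.
Qed.

End measure_space.

Section random_elements.
Context (R : realType).
Local Open Scope ereal_scope.

(* Absolute continuity of the law of X with respect to the law of Y. *)
Definition prec d d' (Omega : measurableType d) (T : measurableType d')
    (P : probability Omega R) (X Y : Omega -> T) :=
  forall A : set T, measurable A -> P (Y @^-1` A) = 0 -> P (X @^-1` A) = 0.

Definition same_law d1 d2 d' (Omega1 : measurableType d1)
    (Omega2 : measurableType d2) (T : measurableType d')
    (P1 : probability Omega1 R) (X1 : Omega1 -> T)
    (P2 : probability Omega2 R) (X2 : Omega2 -> T) :=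
  forall A : set T, measurable A -> P1 (X1 @^-1` A) = P2 (X2 @^-1` A).

Definition independent d d1 d2 (Omega : measurableType d)
    (T1 : measurableType d1) (T2 : measurableType d2)
    (P : probability Omega R) (X : Omega -> T1) (Y : Omega -> T2) :=
  forall (A : set T1) (B : set T2), measurable A -> measurable B ->
    P (X @^-1` A `&` Y @^-1` B) = P (X @^-1` A) * P (Y @^-1` B).

Definition uniform_on n d (Omega : measurableType d)
    (P : probability Omega R) (U : Omega -> 'rV[R]_n) (S : set 'rV[R]_n) :=
  forall B : set 'rV[R]_n, measurable B ->
    P (U @^-1` B) = lebesgue_rV (B `&` S) * ((fine (lebesgue_rV S))^-1)%:E.

End random_elements.

Section translation.
Context (R : realType) (n : nat).

Lemma measurable_addrV (v : 'rV[R]_n) :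
  measurable_fun [set: 'rV[R]_n] (fun x => x + v).
Proof.
apply/measurable_fun_mxP => i j.
under eq_fun do rewrite mxE.
by apply: measurable_funD => //; exact: measurable_mx_coord.
Qed.

Definition translate_fun (v : 'rV[R]_n) (mu : measures 'rV[R]_n R) :=
  pushforward mu (fun x : 'rV[R]_n => x + v).

Section measure.
Variables (v : 'rV[R]_n) (mu : measures 'rV[R]_n R).

Let translate0 : translate_fun v mu set0 = 0%E.
Proof. by rewrite /translate_fun /pushforward preimage_set0 measure0. Qed.

Let translate_ge0 A : (0 <= translate_fun v mu A)%E.
Proof. by rewrite /translate_fun /pushforward measure_ge0. Qed.

Let translate_additive : semi_sigma_additive (translate_fun v mu).
Proof.
by have mv := measurable_addrV v; exact: measure_semi_sigma_additive.
Qed.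

HB.instance Definition _ := isMeasure.Build _ _ _ (translate_fun v mu)
  translate0 translate_ge0 translate_additive.

End measure.

Definition translate (v : 'rV[R]_n) (mu : measures 'rV[R]_n R) :
  measures 'rV[R]_n R := translate_fun v mu.

End translation.

Section point_processes.
Context (R : realType) (n : nat).
Local Open Scope ereal_scope.
Implicit Types mu : measures 'rV[R]_n R.

Definition point_measure mu :=
  exists (D : set nat) (x : nat -> 'rV[R]_n),
    forall B, measurable B -> mu B = \esum_(k in D) \d_(x k) B.

Definition simple_measure mu := forall x : 'rV[R]_n, mu [set x] <= 1.

Definition locally_finite mu :=
  forall B : set 'rV[R]_n, measurable B -> bounded_set B -> mu B < +oo.

Definition simple_lf_point_measures : set (measures 'rV[R]_n R) :=
  [set mu | [/\ point_measure mu, simple_measure mu & locally_finite mu]].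

(* A random element of the space of simple locally finite point measures,
   seen inside the space of all measures, whose evaluation sigma-field induces
   the evaluation sigma-field of the subspace. The larger space is needed as
   the target of Pi + delta_U, which is simple only almost surely. *)
Definition point_process d (Omega : measurableType d)
    (Pi : Omega -> measures 'rV[R]_n R) :=
  measurable_fun [set: Omega] Pi /\
  forall w, simple_lf_point_measures (Pi w).

Definition translation_invariant d (Omega : measurableType d)
    (P : probability Omega R) (Pi : Omega -> measures 'rV[R]_n R) :=
  forall v : 'rV[R]_n, same_law P (fun w => translate v (Pi w)) P Pi.

(* The law of Pi + delta_U is absolutely continuous with respect to that of Pi,
   for U uniform on S and independent of Pi. The original probability space
   need not carry such a U, so Pi is replaced by an arbitrary copy of itself
   defined on the same probability space as U. *)
Definition tolerates_uniform_insertion d (Omega : measurableType d)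
    (P : probability Omega R) (Pi : Omega -> measures 'rV[R]_n R)
    (S : set 'rV[R]_n) :=
  forall d' (Omega' : measurableType d') (P' : probability Omega' R)
    (Pi' : Omega' -> measures 'rV[R]_n R) (U : Omega' -> 'rV[R]_n),
    point_process Pi' -> same_law P' Pi' P Pi ->
    measurable_fun [set: Omega'] U -> uniform_on P' U S ->
    independent P' Pi' U ->
    prec P' (fun w => add_point (Pi' w) (U w)) Pi'.

Definition insertion_tolerant d (Omega : measurableType d)
    (P : probability Omega R) (Pi : Omega -> measures 'rV[R]_n R) :=
  forall S : set 'rV[R]_n, measurable S -> 0 < lebesgue_rV S < +oo ->
    tolerates_uniform_insertion P Pi S.

End point_processes.

(* Main.v *)
Require Import Defs.
From HB Require Import structures.
From mathcomp Require Import all_boot all_order all_algebra.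
From mathcomp Require Import all_classical all_reals all_analysis.
From mathcomp Require Import measurable_realfun.

(** Fix an event [A] that [Pi] almost surely avoids, and let
    [charging_points A] be the Borel set of those [x] for which [Pi + delta_x]
    falls in [A] with positive probability. If [U] is uniform on [S] and
    independent of [Pi], the pair [(U, Pi)] has a product law, so by Fubini
    [Pi + delta_U] avoids [A] almost surely exactly when [charging_points A]
    meets [S] in a Lebesgue-null set ([tolerates_uniform_insertionP]). Tolerance
    on [S] is thereby a statement about null sets of the space, and tolerance
    on every set amounts to [charging_points A] itself being null.

    Assume tolerance on a single [S] of positive finite measure. Pulling [A]
    back along the translation by [v] gives another event that [Pi] almost
    surely avoids, because the law of [Pi] is invariant, and shifts
    [charging_points A] by [- v] ([charging_points_translate]). Hence every
    translate of [charging_points A] meets [S] in a null set. Averaging over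
    all translations,
      [\int lebesgue ((N - v) `&` S) dv = lebesgue N * lebesgue S]
    ([integral_lebesgue_rV_shiftI]), so [charging_points A] is null, and [Pi]
    tolerates insertion on every set.

    The converse only needs some set of positive finite measure, such as the
    unit cube. *)

Set Implicit Arguments.
Unset Strict Implicit.
Unset Printing Implicit Defensive.

Import Order.TTheory GRing.Theory Num.Theory.

Local Open Scope classical_set_scope.
Local Open Scope ring_scope.
Local Open Scope ereal_scope.

(** * Translation invariance of Lebesgue measure *)

Section translation_invariance.
Context (R : realType).

(** The shifted measure gives each half-open interval its length, and Lebesgue
    measure is the only measure that does. *)
Lemma lebesgue_measure_shift (v : R) (A : set R) : measurable A ->
  lebesgue_measure ((fun x => (x + v)%R) @^-1` A) = lebesgue_measure A.
Proof.
move=> mA.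
have mv : measurable_fun [set: measurableTypeR R]
    (fun x : measurableTypeR R => (x + v)%R : measurableTypeR R).
  by apply: measurable_funD => //; exact: measurable_cst.
rewrite -[LHS]/(pushforward (@lebesgue_measure R)
  (fun x : measurableTypeR R => (x + v)%R : measurableTypeR R) A).
apply/esym; apply: (@lebesgue_measure_unique R _ _ A) => //.
move=> _ [[a b] /= _ <-].
rewrite /pushforward.
rewrite (_ : _ @^-1` _ = `](a - v)%R, (b - v)%R]%classic).
  by rewrite !lebesgue_measure_itv /= !lte_fin ltrD2r -!EFinB opprB addrA subrK.
by apply/seteqP; split=> x /=; rewrite !in_itv /= ltrBlDr lerBrDr.
Qed.

Lemma slice_xsection n (A : set 'rV[R]_n.+1) (x : R) :
  [set y : 'rV[R]_n | A (consrV (x, y))] = xsection (@consrV R n @^-1` A) x.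
Proof. by apply/seteqP; split => y; rewrite /xsection /= in_setE. Qed.

Lemma measurable_consrV_preimage n (A : set 'rV[R]_n.+1) : measurable A ->
  measurable (@consrV R n @^-1` A).
Proof.
by move=> mA; rewrite -[X in measurable X]setTI; exact: measurable_consrV.
Qed.

Lemma consrV_shift n (v : 'rV[R]_n.+1) (x : R) (y : 'rV[R]_n) :
  (consrV (x, y) + v)%R =
  consrV ((x + v ord0 ord0)%R, (y + \row_i v ord0 (lift ord0 i))%R).
Proof.
apply/rowP => j; rewrite mxE; have [k ->|->] := unliftP ord0 j.
  by rewrite !consrVS /= !mxE.
by rewrite !consrV0.
Qed.

(** By induction on the dimension: the slice of the translated set at [x] is a
    translate of the slice of [A] at [x + v_0], so the claim follows from the
    lower-dimensional case on each slice and from the invariance of the outer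
    integral on the line. *)
Lemma lebesgue_rV_shift n (v : 'rV[R]_n) (A : set 'rV[R]_n) : measurable A ->
  lebesgue_rV ((fun x => (x + v)%R) @^-1` A) = lebesgue_rV A.
Proof.
elim: n v A => [v A _|n IH v A mA].
  by congr lebesgue_rV; apply/seteqP; split=> x /=; rewrite (thinmx0 v) addr0.
have mE := measurable_consrV_preimage mA.
pose phi x := lebesgue_rV [set y : 'rV[R]_n | A (consrV (x, y))].
have mphi : measurable_fun [set: R] phi.
  rewrite (_ : phi = @lebesgue_rV R n \o xsection (@consrV R n @^-1` A)).
    exact: measurable_fun_xsection.
  by apply/funext => x; rewrite /phi slice_xsection.
have mv : measurable_fun [set: measurableTypeR R]
    (fun x : measurableTypeR R => (x + v ord0 ord0)%R : measurableTypeR R).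
  by apply: measurable_funD => //; exact: measurable_cst.
transitivity (\int[@lebesgue_measure R]_x phi (x + v ord0 ord0)%R).
  rewrite [LHS]/=; apply: eq_integral => x _; rewrite /phi.
  rewrite -[RHS](IH (\row_i v ord0 (lift ord0 i))); last first.
    by rewrite slice_xsection; exact: measurable_xsection.
  by congr lebesgue_rV; apply/seteqP; split => y; rewrite /= consrV_shift.
rewrite -(@ge0_integral_pushforward _ _ _ _ _ _ mv _ setT phi)//=.
apply: eq_measure_integral => B mB _.
exact: lebesgue_measure_shift.
Qed.

End translation_invariance.

(** * Averaging an intersection over all translations *)

Section average.
Context (R : realType) (n : nat).
Implicit Types A B : set 'rV[R]_n.

Lemma measurable_shift (v : 'rV[R]_n) A : measurable A ->
  measurable ((fun x => (x + v)%R) @^-1` A).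
Proof.
by move=> mA; rewrite -[X in measurable X]setTI; exact: measurable_addrV.
Qed.

Lemma measurable_addrV2 :
  measurable_fun [set: 'rV[R]_n * 'rV[R]_n] (fun xv => (xv.1 + xv.2)%R).
Proof.
apply/measurable_fun_mxP => i j.
under eq_fun do rewrite mxE.
by apply: measurable_funD; apply: (measurableT_comp (measurable_mx_coord _ _)).
Qed.

(** Both sides are the product measure of the pairs [(x, v)] with [x \in A] and
    [x + v \in B]: slicing at [v] gives the left-hand side, while the slice at
    [x \in A] is a translate of [B]. *)
Lemma integral_lebesgue_rV_shiftI A B : measurable A -> measurable B ->
  \int[@lebesgue_rV R n]_v lebesgue_rV (((fun x => (x + v)%R) @^-1` B) `&` A) =
  lebesgue_rV B * lebesgue_rV A.
Proof.
move=> mA mB.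
pose E : set ('rV[R]_n * 'rV[R]_n) :=
  ((fun xv => (xv.1 + xv.2)%R) @^-1` B) `&` (fst @^-1` A).
have mE : measurable E.
  apply: measurableI; rewrite -[X in measurable X]setTI.
    exact: measurable_addrV2.
  exact: measurable_fst.
transitivity ((@lebesgue_rV R n \x^ @lebesgue_rV R n) E).
  apply: eq_integral => v _; congr lebesgue_rV.
  by apply/seteqP; split => x; rewrite /ysection /= in_setE.
rewrite -(product_measure_unique (m' := @lebesgue_rV R n \x^ @lebesgue_rV R n)
  (fun _ _ => @product_measure2E _ _ _ _ _ _ _ _ _))//.
(* The slice at x has measure lebesgue B or 0 according to whether A x. *)
rewrite -integral_cst// integral_mkcond; apply: eq_integral => x _ /=.
rewrite patchE; case: ifPn => [/set_mem Ax|/negP nAx].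
  rewrite -[RHS](lebesgue_rV_shift x)//; congr lebesgue_rV.
  by apply/seteqP; split => v; rewrite /xsection /= in_setE /E /= addrC; tauto.
rewrite (_ : xsection E x = set0) ?measure0//.
apply/seteqP; split => v //; rewrite /xsection /= in_setE => -[_ /mem_set].
exact: nAx.
Qed.

Lemma lebesgue_rV_null_of_shifts A B : measurable A -> measurable B ->
  0 < lebesgue_rV A ->
  (forall v, lebesgue_rV (((fun x => (x + v)%R) @^-1` B) `&` A) = 0) ->
  lebesgue_rV B = 0.
Proof.
move=> mA mB A0 BA0; have := integral_lebesgue_rV_shiftI mA mB.
rewrite integral0_eq// => /esym/eqP.
by rewrite mule_eq0 (gt_eqF A0) orbF => /eqP.
Qed.

End average.

(** * Independent pairs *)

Section independent_pair.
Context (R : realType) d d1 d2 (Omega : measurableType d)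
  (T1 : measurableType d1) (T2 : measurableType d2).
Variables (P : probability Omega R) (X : Omega -> T2) (U : Omega -> T1).

(** The pair has the product of the two marginal laws, so the probability of [E]
    is the integral, against the law of [U], of the nonnegative function
    sending [u] to the probability that [X] lies in the slice of [E] at [u]; it
    vanishes exactly when this function does so almost surely. *)
Lemma independent_pair_null (E : set (T1 * T2)) :
  measurable_fun [set: Omega] X -> measurable_fun [set: Omega] U ->
  independent P X U -> measurable E ->
  P ((fun w => (U w, X w)) @^-1` E) = 0 <->
  P (U @^-1` [set u | P (X @^-1` xsection E u) != 0]) = 0.
Proof.
move=> mX mU indep mE.
pose X' : {mfun Omega >-> T2} := HB.pack X (isMeasurableFun.Build _ _ _ _ _ mX).
pose U' : {mfun Omega >-> T1} := HB.pack U (isMeasurableFun.Build _ _ _ _ _ mU).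
have mXU : measurable_fun [set: Omega] (fun w => (U w, X w)).
  exact: measurable_fun_pair.
pose XU' : {mfun Omega >-> (T1 * T2)%type} :=
  HB.pack (fun w => (U w, X w)) (isMeasurableFun.Build _ _ _ _ _ mXU).
rewrite -[X in X = 0 <-> _]/(distribution P XU' E).
rewrite -(@product_measure_unique _ _ _ _ _ (distribution P U')
  (distribution P X') (distribution P XU'))//; last first.
  move=> A B mA mB; rewrite /distribution /pushforward /=.
  by rewrite muleC -indep//; congr (P _); apply/seteqP; split => w /= [].
pose h := distribution P X' \o xsection E.
have mh : measurable_fun [set: T1] h by exact: measurable_fun_xsection.
have h0 u : 0 <= h u by exact: measure_ge0.
rewrite -[X in X = 0 <-> _]/(\int[distribution P U']_u h u).
have -> : \int[distribution P U']_u h u = \int[distribution P U']_u `|h u|.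
  by apply: eq_integral => u _; rewrite gee0_abs.
rewrite (ae_eq_integral_abs _ measurableT mh).
rewrite -[X in _ <-> X = 0]/(distribution P U' [set u | h u != 0]).
have mN : measurable [set u | h u != 0].
  by rewrite -[X in measurable X]setTI; exact: emeasurable_neq.
split.
  move=> hae; apply/negligibleP => //.
  by apply: negligibleS hae => u /= /eqP hu /(_ I).
move=> hN; exists [set u | h u != 0]; split => // u /= hu.
by apply/eqP => hu0; apply: hu => _.
Qed.

End independent_pair.

(** A product space carries copies of random elements of its two factors that
    are independent of each other. *)
Section product_copy.
Context (R : realType) d1 d2 d3 (T1 : measurableType d1)
  (T2 : measurableType d2) (T3 : measurableType d3).
Variables (Q : probability T1 R) (P : probability T2 R).

Lemma product_fst (B : set T1) : measurable B -> (Q \x P) (fst @^-1` B) = Q B.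
Proof.
move=> mB; rewrite -setXT [LHS](product_measure1E Q P mB measurableT).
by rewrite -[RHS]mule1 -(@probability_setT _ _ _ P).
Qed.

Lemma product_snd (C : set T2) : measurable C -> (Q \x P) (snd @^-1` C) = P C.
Proof.
move=> mC; rewrite -setTX [LHS](product_measure1E Q P measurableT mC).
by rewrite -[RHS]mul1e -(@probability_setT _ _ _ Q).
Qed.

Lemma product_independent (X : T2 -> T3) : measurable_fun [set: T2] X ->
  independent (Q \x P) (X \o snd) fst.
Proof.
move=> mX B C mB mC.
have mXB : measurable (X @^-1` B).
  by rewrite -[X in measurable X]setTI; exact: mX.
rewrite /= comp_preimage product_fst// product_snd// muleC.
rewrite -[RHS](product_measure1E Q P mC mXB); congr (_ _).
by apply/seteqP; split => w /= [].
Qed.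

End product_copy.

(** * Events reached by inserting a point *)

Section charging_points.
Context (R : realType) (n : nat).
Local Notation V := 'rV[R]_n.
Local Notation M := (measures 'rV[R]_n R).

Lemma measurable_add_point_preimage (A : set M) : measurable A ->
  measurable [set xmu : V * M | A (add_point xmu.2 xmu.1)].
Proof.
move=> mA; rewrite -[X in measurable X]setTI.
exact: (measurable_add_point measurable_snd measurable_fst measurableT mA).
Qed.

Lemma measurable_translate (v : V) : measurable_fun [set: M] (translate v).
Proof.
apply/measurable_fun_measuresP => A mA.
exact: (measurable_evaluation (measurable_shift v mA)).
Qed.

Lemma translate_add_point (v : V) (mu : M) (x : V) :
  translate v (add_point mu x) = add_point (translate v mu) (x + v)%R.
Proof.
apply: eq_measure; apply/funext => A; rewrite add_pointE.
by rewrite /translate /= /translate_fun /pushforward add_pointE !diracE.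
Qed.

Lemma uniform_on_eq0 d (Omega : measurableType d)
    (P : probability Omega R) (U : Omega -> V) (S B : set V) :
  0 < lebesgue_rV S < +oo -> uniform_on P U S -> measurable B ->
  P (U @^-1` B) = 0 <-> lebesgue_rV (B `&` S) = 0.
Proof.
move=> S0oo uU mB; rewrite uU//.
split => [/eqP|->]; last by rewrite mul0e.
by rewrite mule_eq0 eqe invr_eq0 (gt_eqF (fine_gt0 S0oo)) orbF => /eqP.
Qed.

Context d (Omega : measurableType d) (P : probability Omega R)
  (Pi : Omega -> M).

(** The exceptional set through which the whole argument runs: when [Pi] avoids
    [A] almost surely, tolerance says that a uniform point almost surely misses
    this set. *)
Definition charging_points (A : set M) : set V :=
  [set x | P [set w | A (add_point (Pi w) x)] != 0].

Lemma charging_pointsE (A : set M) : charging_points A =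
  [set x | P (Pi @^-1` xsection [set xmu | A (add_point xmu.2 xmu.1)] x) != 0].
Proof.
apply/funext => x; rewrite /charging_points /=; congr (P _ != 0).
by apply/seteqP; split => w; rewrite /xsection /= in_setE.
Qed.

Lemma measurable_charging_points (A : set M) :
  measurable_fun [set: Omega] Pi -> measurable A ->
  measurable (charging_points A).
Proof.
move=> mPi mA; rewrite charging_pointsE.
pose Pi' : {mfun Omega >-> M} :=
  HB.pack Pi (isMeasurableFun.Build _ _ _ _ _ mPi).
rewrite -[X in measurable X]setTI; apply: emeasurable_neq => //.
apply: (measurable_fun_xsection (distribution P Pi')).
exact: measurable_add_point_preimage.
Qed.

(** Translating [Pi + delta_x] by [v] is inserting [x + v] into the translate of
    [Pi], which has the law of [Pi]. *)
Lemma charging_points_translate (v : V) (A : set M) : measurable A ->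
  translation_invariant P Pi ->
  charging_points (translate v @^-1` A) =
  (fun x => (x + v)%R) @^-1` charging_points A.
Proof.
move=> mA Pi_ti; apply/funext => x; rewrite /charging_points /preimage /=.
have mAx : measurable [set mu : M | A (add_point mu (x + v)%R)].
  rewrite (_ : [set mu | _] =
    xsection [set xmu : V * M | A (add_point xmu.2 xmu.1)] (x + v)%R).
    by apply: measurable_xsection; exact: measurable_add_point_preimage.
  by apply/seteqP; split => mu; rewrite /xsection /= in_setE.
congr (_ != 0); rewrite -[RHS](Pi_ti v _ mAx); congr (P _).
by apply/funext => w /=; rewrite translate_add_point.
Qed.

(** Tolerance speaks of every coupling of [Pi] with an independent uniform
    point. The probability of reaching [A] depends only on the joint law, which
    is the same product in all of them, so it suffices to have one coupling: the
    product of the uniform law on [S] with the original space. *)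
Lemma tolerates_uniform_insertionP (S : set V) : point_process Pi ->
  measurable S -> 0 < lebesgue_rV S < +oo ->
  tolerates_uniform_insertion P Pi S <->
  forall A : set M, measurable A -> P (Pi @^-1` A) = 0 ->
    lebesgue_rV (charging_points A `&` S) = 0.
Proof.
move=> Pi_pp mS S0oo; have mPi := Pi_pp.1; split => [tolS A mA PA0|nullS].
  (* The Dirac mass is the default of the normalization when the total mass is
     0 or infinite, which the measure of S excludes. *)
  pose Q : probability V R :=
    mnormalize (mrestr (@lebesgue_rV R n) mS) (\d_(0%R : V)).
  have uQ : uniform_on (Q \x P) fst S.
    move=> B mB; rewrite /= product_fst// /Q /= /mnormalize /= /mrestr setTI.
    by have /andP[S0 Soo] := S0oo; rewrite gt_eqF//= lt_eqF.
  have indep : independent (Q \x P) (Pi \o snd) fst.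
    exact: product_independent.
  have mPi_snd : measurable_fun [set: V * Omega] (Pi \o snd).
    exact: measurableT_comp.
  have same : same_law (Q \x P) (Pi \o snd) P Pi.
    move=> B mB; rewrite /= comp_preimage product_snd//.
    by rewrite -[X in measurable X]setTI; exact: mPi.
  have mE := measurable_add_point_preimage mA.
  apply/(uniform_on_eq0 S0oo uQ (measurable_charging_points mPi mA)).
  have := tolS _ _ (Q \x P) (Pi \o snd) fst _ same measurable_fst uQ indep A mA.
  rewrite same// => /(_ _ PA0) null.
  have := (independent_pair_null mPi_snd measurable_fst indep mE).1 (null _).
  rewrite (_ : [set u | _] = charging_points A); last first.
    rewrite charging_pointsE; apply/funext => x.
    by rewrite /mkset same//; exact: measurable_xsection.
  by apply; split => // w; exact: Pi_pp.2.
move=> d' Omega' P' Pi' U [mPi' _] PiPi' mU uU indep A mA PA0.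
pose E := [set xmu : V * M | A (add_point xmu.2 xmu.1)].
have mE : measurable E by exact: measurable_add_point_preimage.
apply/(independent_pair_null mPi' mU indep mE).
rewrite (_ : [set u | _] = charging_points A).
  apply/(uniform_on_eq0 S0oo uU (measurable_charging_points mPi mA)).
  by apply: nullS; rewrite -?PiPi'.
rewrite charging_pointsE; apply/funext => x /=.
by rewrite PiPi'//; exact: measurable_xsection.
Qed.

End charging_points.

Lemma lebesgue_rV_unit_cube (R : realType) (n : nat) :
  lebesgue_rV [set v : 'rV[R]_n | forall i, `[0%R, 1%R]%classic (v ord0 i)] = 1.
Proof.
rewrite (lebesgue_rV_box (A := fun=> `[0%R, 1%R]%classic)) => [|i].
  by rewrite big1// => i _; rewrite lebesgue_measure_itv /= lte01 sube0.
exact: measurable_itv.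
Qed.

Theorem proposition3 (R : realType) (n : nat) (n_gt0 : (0 < n)%N)
  (d : measure_display) (Omega : measurableType d) (P : probability Omega R)
  (Pi : Omega -> measures 'rV[R]_n R) (Pi_pp : point_process Pi)
  (Pi_ti : translation_invariant P Pi) :
  insertion_tolerant P Pi <->
  exists S : set 'rV[R]_n,
    [/\ measurable S, 0 < lebesgue_rV S < +oo &
        tolerates_uniform_insertion P Pi S].
Proof.
split=> [tol|[S [mS S0oo tolS]] S' mS' S'0oo].
  pose C := [set v : 'rV[R]_n | forall i, `[0%R, 1%R]%classic (v ord0 i)].
  have mC : measurable C.
    by apply: (measurable_box (A := fun=> `[0%R, 1%R]%classic)) => i.
  have C0oo : 0 < lebesgue_rV C < +oo.
    by rewrite lebesgue_rV_unit_cube lte01 ltry.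
  by exists C; split => //; exact: tol.
have mPi := Pi_pp.1.
apply/tolerates_uniform_insertionP => // A mA PA0.
have mcharging := measurable_charging_points P mPi mA.
have charging0 : lebesgue_rV (charging_points P Pi A) = 0.
  apply: (lebesgue_rV_null_of_shifts mS mcharging) => [|v].
    by case/andP: S0oo.
  rewrite -charging_points_translate//.
  have mvA : measurable (translate v @^-1` A).
    by rewrite -[X in measurable X]setTI; exact: measurable_translate.
  move/tolerates_uniform_insertionP : tolS; apply => //.
  by rewrite -comp_preimage [LHS](Pi_ti v).
apply: (subset_measure0 _ mcharging) => //.
exact: measurableI.
Qed.
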